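(* Let $G$ be a three dimensional Lie group with a bi-invariant metric, let $\alpha:I\subset\mathbb{R}\to G$ be a parametrized curve with arc length parameter $s$, and let $\beta:\overline I\subset\mathbb{R}\to G$ be a curve with arc length parameter $\overline s$. Then $\beta$ is the Mannheim partner curve of $\alpha$ if and only if the curvature $\varkappa_\beta$ and the torsion $\tau_\beta$ of $\beta$ satisfy the equation $$\frac{d(\varkappa_\beta H_\beta)}{d\overline s}=\frac{\varkappa_\beta}{\mu}\left(1+\mu^{2}\varkappa_\beta^{2}H_\beta^{2}\right),$$ where $\mu$ is constant and $H_\beta$ is the harmonic curvature function of the curve $\beta$.
   Context: $G$ is a three dimensional Lie group with bi-invariant metric $\langle\cdot,\cdot\rangle$, Levi-Civita connection $D$ and Lie algebra $\mathfrak{g}\cong T_eG$ of left-invariant fields, so $\langle X,[Y,Z]\rangle=\langle[X,Y],Z\rangle$ and $D_XY=\frac12[X,Y]$ for $X,Y,Z\in\mathfrak{g}$. Fix an orthonormal basis $X_1,X_2,X_3$ of $\mathfrak{g}$. A vector field $W$ along a curve is written $W=\sum_i w_iX_i$ with smooth functions $w_i$ (the Lie bracket of two such fields being taken bilinearly at each point); the dot denotes the componentwise derivative $\dot W=\sum_i \dot w_iX_i$, and the covariant derivative of $W$ along a curve with tangent $T$ is $\dot W+\frac12[T,W]$. Frenet apparatus $(T,N,B,\varkappa,\tau)$ of an arc length parametrized curve: $T$ is the unit tangent, and $\{T,N,B\}$ is an orthonormal frame along the curve (tangent, principal normal, binormal) with $B=T\times N$, satisfying $D_TT=\varkappa N$,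 $D_TN=-\varkappa T+\tau B$, $D_TB=-\tau N$, where $\varkappa=\|\dot T\|$ is the curvature and $\tau$ the torsion. Put $\tau_G=\frac12\langle[T,N],B\rangle$. The harmonic curvature function is $H=\dfrac{\tau-\tau_G}{\varkappa}$. Quantities with subscript $\beta$ are those of the curve $\beta$; in particular $H_\beta=(\tau_\beta-\tau_{G_\beta})/\varkappa_\beta$ with $\tau_{G_\beta}=\frac12\langle[T_\beta,N_\beta],B_\beta\rangle$. Mannheim curves: a curve $\alpha$ in $G$ is a Mannheim curve if there exists a curve $\beta$ in $G$ and a bijection $\psi$ from $\alpha$ to $\beta$ such that, at points corresponding under $\psi$, the principal normal vector field $N$ of $\alpha$ and the binormal vector field $B_\beta$ of $\beta$ are linearly dependent. In this case $\beta$ is called the Mannheim partner curve of $\alpha$. The partner curve is given by $\beta(s)=\alpha(s)+\lambda(s)N(s)$, $s\in I$, with $\lambda$ a smooth function on $I$; correspondingly $\alpha(\overline s)=\beta(\overline s)+\mu(\overline s)B_\beta(\overline s)$ for some function $\mu$. These relations are used through their derivatives, computed componentwise: $T_\beta\frac{d\overline s}{ds}=T+\lambda'N+\lambda\dot N$ and $T\frac{ds}{d\overline s}=T_\beta+\mu'B_\beta+\mu\dot B_\beta$. *)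

(* Defs.v *)
From HB Require Import structures.
From mathcomp Require Import all_boot all_order all_algebra.
From mathcomp Require Import all_classical all_reals all_analysis.

Set Implicit Arguments.
Unset Strict Implicit.
Unset Printing Implicit Defensive.

Import Order.TTheory GRing.Theory Num.Theory.
Import numFieldNormedType.Exports.

Local Open Scope classical_set_scope.
Local Open Scope ring_scope.

(* C^oo for maps between finite-dimensional normed spaces: all iterated
   directional derivatives exist and are continuous at the points of U.  U is
   an open set in every use below. *)
Fixpoint iter_derive (R : realType) (V W : normedModType R) (f : V -> W)
    (vs : seq V) : V -> W :=
  if vs is v :: vs' then fun x => 'D_v (iter_derive f vs') x else f.

Definition smooth_on (R : realType) (V W : normedModType R) (U : set V)
    (f : V -> W) : Prop :=
  forall (vs : seq V) (x : V), U x ->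
    {for x, continuous (iter_derive f vs)} /\
    forall v : V, derivable (iter_derive f vs) x v.

HB.structure Definition TopGroup := {G of Group G & Topological G}.

Record chart (R : realType) (G : topologicalType) := Chart {
  chart_dom : set G;
  chart_map : G -> 'rV[R]_3;
  chart_inv : 'rV[R]_3 -> G;
  chart_dom_open : open chart_dom;
  chart_img_open : open (chart_map @` chart_dom);
  chart_mapK : forall p, chart_dom p -> chart_inv (chart_map p) = p;
  chart_map_continuous : {within chart_dom, continuous chart_map};
  chart_inv_continuous :
    {within chart_map @` chart_dom, continuous chart_inv} }.

(* Three-dimensional Lie groups; the atlas need not be maximal. *)
Record lieGroup3 (R : realType) := LieGroup3 {
  lie_sort :> TopGroup.type;
  lie_hausdorff : hausdorff_space lie_sort;
  lie_second_countable : @second_countable lie_sort;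
  lie_mul_continuous :
    continuous (fun x : lie_sort * lie_sort => (x.1 * x.2)%g);
  lie_inv_continuous : continuous (fun x : lie_sort => x^-1%g);
  atlas : set (chart R lie_sort);
  atlas_cover : forall p : lie_sort, exists2 c, atlas c & chart_dom c p;
  atlas_compatible : forall c d, atlas c -> atlas d ->
    smooth_on (chart_map c @` (chart_dom c `&` chart_dom d))
      (chart_map d \o chart_inv c);
  lie_mul_smooth : forall c d e, atlas c -> atlas d -> atlas e ->
    smooth_on
      [set x : 'rV[R]_3 * 'rV[R]_3 |
        [/\ (chart_map c @` chart_dom c) x.1,
            (chart_map d @` chart_dom d) x.2 &
            chart_dom e (chart_inv c x.1 * chart_inv d x.2)%g]]
      (fun x => chart_map e (chart_inv c x.1 * chart_inv d x.2)%g);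
  lie_inv_smooth : forall c d, atlas c -> atlas d ->
    smooth_on
      [set x : 'rV[R]_3 | (chart_map c @` chart_dom c) x /\
                          chart_dom d ((chart_inv c x)^-1)%g]
      (fun x => chart_map d ((chart_inv c x)^-1)%g) }.

Definition smooth_fun (R : realType) (G : lieGroup3 R) (f : G -> R) : Prop :=
  forall c, atlas c ->
    smooth_on (chart_map c @` chart_dom c) (f \o chart_inv c).

(* Vector fields are derivations of the algebra of smooth functions; the value
   of an operator on non-smooth functions is irrelevant. *)
Definition operator (R : realType) (G : lieGroup3 R) := (G -> R) -> G -> R.

Record vector_field (R : realType) (G : lieGroup3 R) (X : operator G) : Prop :=
  VectorField {
  vf_smooth : forall f, smooth_fun f -> smooth_fun (X f);
  vf_linear : forall (a : R) (f h : G -> R), smooth_fun f -> smooth_fun h ->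
    forall p, X (fun q => a * f q + h q) p = a * X f p + X h p;
  vf_leibniz : forall f h : G -> R, smooth_fun f -> smooth_fun h ->
    forall p, X (fun q => f q * h q) p = f p * X h p + h p * X f p }.

Definition lie_bracket (R : realType) (G : lieGroup3 R) (X Y : operator G) :
    operator G :=
  fun f p => X (Y f) p - Y (X f) p.

(* Pushforward of X by the bijection phi with inverse phi'. *)
Definition pushforward (R : realType) (G : lieGroup3 R) (phi phi' : G -> G)
    (X : operator G) : operator G :=
  fun f p => X (f \o phi) (phi' p).

Definition left_push (R : realType) (G : lieGroup3 R) (a : G) :=
  pushforward (fun p : G => (a * p)%g) (fun p : G => (a^-1 * p)%g).

Definition right_push (R : realType) (G : lieGroup3 R) (a : G) :=
  pushforward (fun p : G => (p * a)%g) (fun p : G => (p * a^-1)%g).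

Definition left_invariant (R : realType) (G : lieGroup3 R) (X : operator G) :
    Prop :=
  forall a f p, smooth_fun f -> left_push a X f p = X f p.

(* A Riemannian metric as a symmetric tensor: a form on vector fields, bilinear
   over the smooth functions and positive definite at every point. *)
Record riemannian_metric (R : realType) (G : lieGroup3 R)
    (g : operator G -> operator G -> G -> R) : Prop := RiemannianMetric {
  metric_smooth : forall X Y, vector_field X -> vector_field Y ->
    smooth_fun (g X Y);
  metric_sym : forall X Y, vector_field X -> vector_field Y ->
    forall p, g X Y p = g Y X p;
  metric_linear : forall (f : G -> R) X Y Z, smooth_fun f ->
    vector_field X -> vector_field Y -> vector_field Z -> forall p,
    g (fun h q => f q * X h q + Y h q) Z p = f p * g X Z p + g Y Z p;
  metric_ge0 : forall X, vector_field X -> forall p, 0 <= g X X p;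
  metric_eq0 : forall X, vector_field X -> forall p,
    g X X p = 0 <-> (forall f, smooth_fun f -> X f p = 0) }.

Record bi_invariant_metric (R : realType) (G : lieGroup3 R)
    (g : operator G -> operator G -> G -> R) : Prop := BiInvariantMetric {
  bi_riemannian : riemannian_metric g;
  bi_left : forall a X Y, vector_field X -> vector_field Y ->
    forall p, g (left_push a X) (left_push a Y) (a * p)%g = g X Y p;
  bi_right : forall a X Y, vector_field X -> vector_field Y ->
    forall p, g (right_push a X) (right_push a Y) (p * a)%g = g X Y p }.

Record orthonormal_basis (R : realType) (G : lieGroup3 R)
    (g : operator G -> operator G -> G -> R) (X : 'I_3 -> operator G) : Prop :=
  OrthonormalBasis {
  basis_field : forall i, vector_field (X i);
  basis_left : forall i, left_invariant (X i);
  basis_orthonormal : forall i j p, g (X i) (X j) p = (i == j)%:R }.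

(* From here on the Lie algebra is identified with 'rV[R]_3 through the
   orthonormal basis X. *)
Definition field_of (R : realType) (G : lieGroup3 R) (X : 'I_3 -> operator G)
    (w : 'rV[R]_3) : operator G :=
  fun f p => \sum_i w 0 i * X i f p.

(* Coordinates of [u, v], read off by orthonormality; the metric is constant on
   left-invariant fields, so evaluating it at the identity loses nothing. *)
Definition bracket (R : realType) (G : lieGroup3 R)
    (g : operator G -> operator G -> G -> R) (X : 'I_3 -> operator G)
    (u v : 'rV[R]_3) : 'rV[R]_3 :=
  \row_k g (lie_bracket (field_of X u) (field_of X v)) (X k) 1%g.

Definition dot (R : realType) (u v : 'rV[R]_3) : R := \sum_i u 0 i * v 0 i.

(* The norm of the metric, as opposed to the sup norm `|u| of the library. *)
Definition enorm (R : realType) (u : 'rV[R]_3) : R := Num.sqrt (dot u u).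

(* Indices are added modulo 3. *)
Definition cross (R : realType) (u v : 'rV[R]_3) : 'rV[R]_3 :=
  \row_(k < 3) (u 0 (k + 1) * v 0 (k + 2%:R) - u 0 (k + 2%:R) * v 0 (k + 1)).

Definition smooth_curve (R : realType) (G : lieGroup3 R) (I : set R)
    (alpha : R -> G) : Prop :=
  forall f, smooth_fun f -> smooth_on I (f \o alpha).

Definition velocity (R : realType) (G : lieGroup3 R) (X : 'I_3 -> operator G)
    (I : set R) (alpha : R -> G) (T : R -> 'rV[R]_3) : Prop :=
  forall s f, I s -> smooth_fun f ->
    is_derive s 1 (f \o alpha) (field_of X (T s) f (alpha s)).

(* Covariant derivative of W along a curve with tangent T, for the Levi-Civita
   connection D_X Y = [X, Y] / 2 of a bi-invariant metric. *)
Definition cov (R : realType) (G : lieGroup3 R)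
    (g : operator G -> operator G -> G -> R) (X : 'I_3 -> operator G)
    (T W : R -> 'rV[R]_3) (s : R) : 'rV[R]_3 :=
  derive1 W s + 2^-1 *: bracket g X (T s) (W s).

Record frenet (R : realType) := Frenet {
  tan_ : R -> 'rV[R]_3;
  nor_ : R -> 'rV[R]_3;
  bin_ : R -> 'rV[R]_3;
  curv : R -> R;
  tors : R -> R }.

(* F is a Frenet apparatus of the curve alpha, parametrized by arc length.  The
   curvature may vanish as long as the frame stays smooth. *)
Record frenet_apparatus (R : realType) (G : lieGroup3 R)
    (g : operator G -> operator G -> G -> R) (X : 'I_3 -> operator G)
    (I : set R) (alpha : R -> G) (F : frenet R) : Prop := FrenetApparatus {
  frenet_curve : smooth_curve I alpha;
  frenet_velocity : velocity X I alpha (tan_ F);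
  frenet_tan_smooth : smooth_on I (tan_ F);
  frenet_nor_smooth : smooth_on I (nor_ F);
  frenet_bin_smooth : smooth_on I (bin_ F);
  frenet_tan_unit : forall s, I s -> enorm (tan_ F s) = 1;
  frenet_nor_unit : forall s, I s -> enorm (nor_ F s) = 1;
  frenet_orthogonal : forall s, I s -> dot (tan_ F s) (nor_ F s) = 0;
  frenet_bin : forall s, I s -> bin_ F s = cross (tan_ F s) (nor_ F s);
  frenet_curv : forall s, I s -> curv F s = enorm (derive1 (tan_ F) s);
  frenet_tan_eq : forall s, I s ->
    cov g X (tan_ F) (tan_ F) s = curv F s *: nor_ F s;
  frenet_nor_eq : forall s, I s ->
    cov g X (tan_ F) (nor_ F) s =
      - curv F s *: tan_ F s + tors F s *: bin_ F s;
  frenet_bin_eq : forall s, I s ->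
    cov g X (tan_ F) (bin_ F) s = - tors F s *: nor_ F s }.

Definition tors_G (R : realType) (G : lieGroup3 R)
    (g : operator G -> operator G -> G -> R) (X : 'I_3 -> operator G)
    (F : frenet R) (s : R) : R :=
  2^-1 * dot (bracket g X (tan_ F s) (nor_ F s)) (bin_ F s).

Definition harmonic_curv (R : realType) (G : lieGroup3 R)
    (g : operator G -> operator G -> G -> R) (X : 'I_3 -> operator G)
    (F : frenet R) (s : R) : R :=
  (tors F s - tors_G g X F s) / curv F s.

(* psi : I -> J is a bijection with inverse psi', both smooth: the point of
   parameter s of one curve corresponds to that of parameter psi s of the
   other. *)
Record correspondence (R : realType) (I J : set R) (psi psi' : R -> R) : Prop :=
  Correspondence {
  corr_bij : set_bij I J psi;
  corr_bij' : set_bij J I psi';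
  corr_K : forall s, I s -> psi' (psi s) = s;
  corr_smooth : smooth_on I psi;
  corr_smooth' : smooth_on J psi' }.

(* The relation  delta (psi s) = gamma s + lam s * W s  between the curves gamma
   and delta with tangents T and T', where W is a field along gamma.  The sum
   has no meaning in G: the relation stands for its componentwise derivative
     T' (psi s) * psi' s = T s + lam' s * W s + lam s * W' s. *)
Definition offset (R : realType) (I : set R) (psi : R -> R)
    (T W T' : R -> 'rV[R]_3) (lam : R -> R) : Prop :=
  forall s, I s ->
    derive1 psi s *: T' (psi s) =
      T s + derive1 lam s *: W s + lam s *: derive1 W s.

(* The curve with apparatus Fb (on J) is the Mannheim partner curve of the one
   with apparatus F (on I). *)
Definition mannheim_partner (R : realType) (I J : set R) (F Fb : frenet R) :
    Prop :=
  exists psi psi' : R -> R, correspondence I J psi psi' /\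
    (forall s, I s -> ~~ free [:: nor_ F s; bin_ Fb (psi s)]) /\
    exists lam : R -> R, smooth_on I lam /\
      offset I psi (tan_ F) (nor_ F) (tan_ Fb) lam.

(* Main.v *)
(* Write s = tau - tau_G.  The componentwise derivatives of an orthonormal frame
   form a skew matrix, so the Frenet equations for the covariant derivative give
   T' = kappa N, N' = - kappa T + s B, B' = - s N: the Lie group enters only
   through s, and for beta one has s = kappa_beta H_beta.  Let phi be the
   parameter change from beta to alpha, with T, N, kappa those of alpha and
   (t, n, b), k, s those of beta.

   For constant mu = c the offset relation reads phi' T(phi) = t - c s n.
   Differentiating <T(phi), n + c s t> = 0 gives
     phi'^2 kappa <N(phi), n + c s t> = k (1 + c^2 s^2) - c s',
   and differentiating <T(phi), b> = 0 gives
     phi'^2 kappa <N(phi), b> = - c s^2.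
   If N(phi) is parallel to b the first left-hand side vanishes, which is the
   differential equation for s.  Conversely the equation forces N(phi) to be
   parallel to b wherever kappa <> 0, hence wherever s <> 0.  When N(phi) is
   eps b, the sign eps is constant and the two offset relations correspond
   through lambda = - eps c. *)
Require Import Defs.
From HB Require Import structures.
From mathcomp Require Import all_boot all_order all_algebra.
From mathcomp Require Import all_classical all_reals all_analysis.
From mathcomp Require Import ring lra.

Set Implicit Arguments.
Unset Strict Implicit.
Unset Printing Implicit Defensive.

Import Order.TTheory GRing.Theory Num.Theory.
Import numFieldNormedType.Exports.

Local Open Scope classical_set_scope.
Local Open Scope ring_scope.

(** * Euclidean geometry of coordinate vectors *)

Section Dot.
Variable R : realType.
Implicit Types u v w : 'rV[R]_3.

Lemma dotE u v :
  dot u v = u 0 0 * v 0 0 + u 0 1 * v 0 1 + u 0 2%:R * v 0 2%:R.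
Proof.
rewrite /dot !big_ord_recl big_ord0 addr0 addrA.
by congr (_ * _ + _ * _ + _ * _); congr (_ _ _); apply: val_inj.
Qed.

Lemma dotC u v : dot u v = dot v u.
Proof. by rewrite !dotE; ring. Qed.

Lemma dotDl u v w : dot (u + v) w = dot u w + dot v w.
Proof. by rewrite !dotE !mxE; ring. Qed.

Lemma dotZl a u v : dot (a *: u) v = a * dot u v.
Proof. by rewrite !dotE !mxE; ring. Qed.

Lemma dotDr u v w : dot u (v + w) = dot u v + dot u w.
Proof. by rewrite !(dotC u) dotDl. Qed.

Lemma dotZr a u v : dot u (a *: v) = a * dot u v.
Proof. by rewrite !(dotC u) dotZl. Qed.

Lemma dotNl u v : dot (- u) v = - dot u v.
Proof. by rewrite -scaleN1r dotZl mulN1r. Qed.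

Lemma dotNr u v : dot u (- v) = - dot u v.
Proof. by rewrite !(dotC u) dotNl. Qed.

Lemma dot0l u : dot 0 u = 0.
Proof. by rewrite -(scale0r u) dotZl mul0r. Qed.

Lemma dot_ge0 u : 0 <= dot u u.
Proof. by apply: sumr_ge0 => i _; rewrite -expr2 sqr_ge0. Qed.

Lemma enorm1_dot u : enorm u = 1 -> dot u u = 1.
Proof.
by move=> u1; rewrite -(sqr_sqrtr (dot_ge0 u)) -/(enorm u) u1 expr1n.
Qed.

Lemma crossE u v : [/\ cross u v 0 0 = u 0 1 * v 0 2%:R - u 0 2%:R * v 0 1,
  cross u v 0 1 = u 0 2%:R * v 0 0 - u 0 0 * v 0 2%:R &
  cross u v 0 2%:R = u 0 0 * v 0 1 - u 0 1 * v 0 0].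
Proof.
by split; rewrite mxE; congr (u _ _ * v _ _ - u _ _ * v _ _); apply: val_inj.
Qed.

Lemma dot_crossl u v : dot (cross u v) u = 0.
Proof. by have [e0 e1 e2] := crossE u v; rewrite dotE e0 e1 e2; ring. Qed.

Lemma dot_crossr u v : dot (cross u v) v = 0.
Proof. by have [e0 e1 e2] := crossE u v; rewrite dotE e0 e1 e2; ring. Qed.

Lemma dot_cross_cross u v :
  dot (cross u v) (cross u v) = dot u u * dot v v - dot u v ^+ 2.
Proof. by have [e0 e1 e2] := crossE u v; rewrite !dotE e0 e1 e2; ring. Qed.

Definition orthonormal3 (t n b : 'rV[R]_3) : Prop :=
  [/\ dot t t = 1, dot n n = 1 & dot b b = 1] /\
  [/\ dot t n = 0, dot t b = 0 & dot n b = 0].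

(** The matrix [M] with rows [t], [n], [b] has its transpose as a right inverse. Being square, it
    has it as a left inverse too, and [v *m M^T *m M] is the expansion. *)
Lemma orthonormal3_expand t n b v : orthonormal3 t n b ->
  v = dot v t *: t + dot v n *: n + dot v b *: b.
Proof.
move=> [[tt nn bb] [tn tb nb]].
pose M : 'M[R]_3 := \matrix_(i, j) (nth 0 [:: t; n; b] i) 0 j.
have MM : M *m M^T = 1%:M.
  apply/matrixP => i j; rewrite !mxE.
  transitivity (dot (nth 0 [:: t; n; b] i) (nth 0 [:: t; n; b] j)).
    by apply: eq_bigr => k _; rewrite !mxE.
  case: i => [[|[|[|//]]] ?]; case: j => [[|[|[|//]]] ?] //=;
    by rewrite ?tt ?nn ?bb ?tn ?tb ?nb // dotC ?tn ?tb ?nb.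
have {1}-> : v = v *m M^T *m M by rewrite -mulmxA (mulmx1C MM) mulmx1.
apply/rowP => j; rewrite !mxE !big_ord_recl big_ord0 addr0 addrA !mxE /=.
by congr (_ * _ + _ * _ + _ * _); apply: eq_bigr => k _; rewrite !mxE.
Qed.

Lemma orthonormal3_eqP t n b v w : orthonormal3 t n b ->
  dot v t = dot w t -> dot v n = dot w n -> dot v b = dot w b -> v = w.
Proof.
move=> tnb vt vn vb.
by rewrite (orthonormal3_expand v tnb) vt vn vb -orthonormal3_expand.
Qed.

(** Since [v] is nonzero, dependence makes [u] a multiple of [v]; pairing with [v] gives the
    coefficient. *)
Lemma dependent_unit u v : dot u u = 1 -> dot v v = 1 ->
  ~~ free [:: u; v] -> u = dot u v *: v.
Proof.
move=> uu vv; rewrite free_cons seq1_free negb_and !negbK => /orP[|/eqP v0].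
  by rewrite span_seq1 => /vlineP[a ->]; rewrite dotZl vv mulr1.
by move: vv; rewrite v0 dot0l => /esym/eqP; rewrite oner_eq0.
Qed.

Lemma scale_dependent a v : ~~ free [:: a *: v; v].
Proof.
rewrite free_cons span_seq1 negb_and negbK.
by apply/orP; left; apply/vlineP; exists a.
Qed.

End Dot.

(** * Derivatives of functions known only on an open set of parameters *)

Section Calculus.
Variable R : realType.

Lemma is_derive_mxP m n (V : R -> 'M[R]_(m, n)) (x : R) dV :
  is_derive x 1 V dV <-> forall i j, is_derive x 1 (fun u => V u i j) (dV i j).
Proof.
split=> [[dv <-] i j|h].
  by split; [exact: (derivable_mxP _ _ _).1 | rewrite derive_mx // mxE].
have dv : derivable V x 1 by apply/derivable_mxP => i j; have [] := h i j.
split=> //; rewrite derive_mx //; apply/matrixP => i j.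
by rewrite mxE; have [] := h i j.
Qed.

Lemma is_derive_derive1 (W : normedModType R) (f : R -> W) (x : R) df :
  is_derive x 1 f df -> derive1 f x = df.
Proof. by move=> [_ <-]; exact: derive1E. Qed.

Lemma is_derive_mul (f h : R -> R) (x a b : R) :
  is_derive x 1 f a -> is_derive x 1 h b ->
  is_derive x 1 (fun u => f u * h u) (a * h x + f x * b).
Proof.
move=> fa hb; have := is_deriveM fa hb.
by rewrite /GRing.scale /= addrC [h x * a]mulrC.
Qed.

Lemma is_derive_dot (V W : R -> 'rV[R]_3) (x : R) dV dW :
  is_derive x 1 V dV -> is_derive x 1 W dW ->
  is_derive x 1 (fun u => dot (V u) (W u)) (dot dV (W x) + dot (V x) dW).
Proof.
move=> /is_derive_mxP hV /is_derive_mxP hW.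
have := is_derive_sum (fun i => is_derive_mul (hV 0 i) (hW 0 i)).
rewrite big_split /= -/(dot _ _) -/(dot _ _); congr (is_derive _ _ _ _).
by apply/funext => u; rewrite fct_sumE.
Qed.

Lemma is_derive_comp_mx m n (V : R -> 'M[R]_(m, n)) (f : R -> R) (x : R) dV a :
  is_derive (f x) 1 V dV -> is_derive x 1 f a ->
  is_derive x 1 (V \o f) (a *: dV).
Proof.
move=> /is_derive_mxP hV hf; apply/is_derive_mxP => i j.
by rewrite mxE mulrC; exact: (is_derive1_comp (hV i j) hf).
Qed.

Variables (U : set R) (openU : open U).

Lemma is_derive_on (W : normedModType R) (f h : R -> W) (x : R) df :
  (forall u, U u -> f u = h u) -> U x -> is_derive x 1 f df ->
  is_derive x 1 h df.
Proof.
move=> fh Ux; apply: near_eq_is_derive.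
have : nbhs x U by exact: open_nbhs_nbhs.
by apply: filterS.
Qed.

Lemma is_derive_unique (W : normedModType R) (f : R -> W) (x : R) a b :
  is_derive x 1 f a -> is_derive x 1 f b -> a = b.
Proof. by move=> [_ <-] [_ <-]. Qed.

Lemma is_derive_on_cst (W : normedModType R) (f : R -> W) c (x : R) df :
  (forall u, U u -> f u = c) -> U x -> is_derive x 1 f df -> df = 0.
Proof.
move=> fc Ux hf; apply: (is_derive_unique hf).
by apply: (@is_derive_on _ (cst c)) => // u /fc ->.
Qed.

(** By the mean value theorem: the interval hypothesis keeps the segment between the two points
    inside [U]. *)
Lemma is_derive0_interval (f : R -> R) : is_interval U ->
  (forall x, U x -> is_derive x 1 f 0) ->
  forall x y, U x -> U y -> f x = f y.
Proof.
move=> itvU f0 x y.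
wlog xy : x y / x <= y => [th Ux Uy|Ux Uy].
  by have [/th|/ltW/th yx] := leP x y; [exact|rewrite yx].
have inU z : x <= z <= y -> U z by apply: itvU.
have fc : {within `[x, y], continuous f}.
  apply: derivable_within_continuous => z.
  by rewrite in_itv /= => zxy; have [] := f0 _ (inU _ zxy).
have [|c _] := @MVT_segment _ f (cst 0) x y xy _ fc.
  by move=> z; rewrite in_itv /= => /andP[xz zy]; apply/f0/inU; rewrite !ltW.
by rewrite mul0r => /eqP; rewrite subr_eq0 => /eqP.
Qed.

Lemma smooth_on_derive1 (W : normedModType R) (f : R -> W) (x : R) :
  smooth_on U f -> U x -> is_derive x 1 f (derive1 f x).
Proof.
move=> sf Ux; rewrite derive1E; apply/derivableP.
by have [_ /(_ 1)] := sf [::] x Ux.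
Qed.

(** Second derivatives are needed because s = <N', B> has to be differentiated. *)
Lemma smooth_on_derivable_derive1 (W : normedModType R) (f : R -> W) (x : R) :
  smooth_on U f -> U x -> is_derive x 1 (derive1 f) ('D_1 (derive1 f) x).
Proof.
move=> sf Ux; apply/derivableP.
have -> : derive1 f = 'D_1 f by apply/funext => u; rewrite derive1E.
by have [_ /(_ 1)] := sf [:: 1] x Ux.
Qed.

End Calculus.

Lemma smooth_on_cst (R : realType) (V W : normedModType R) (U : set V) (c : W) :
  smooth_on U (fun=> c).
Proof.
move=> vs x _.
have [c' ->] : exists c', iter_derive (fun=> c) vs = cst c'.
  elim: vs => [|v vs [c' IH]]; first by exists c.
  by exists 0; apply/funext => y /=; rewrite IH derive_cst.
by split=> [|v]; [exact: cst_continuous|exact: derivable_cst].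
Qed.

(** * From the Frenet apparatus in the group to componentwise Frenet equations *)

Section Frame.
Variable R : realType.

(** These are the Frenet equations of Euclidean space, with [s] in the place of the torsion. The
    field [frame_ds] is there because the equation to be proved contains s'. *)
Record moving_frame (U : set R) (T N B : R -> 'rV[R]_3) (k s : R -> R) :
    Prop := MovingFrame {
  frame_orthonormal : forall x, U x -> orthonormal3 (T x) (N x) (B x);
  frame_dT : forall x, U x -> is_derive x 1 T (k x *: N x);
  frame_dN : forall x, U x -> is_derive x 1 N (- k x *: T x + s x *: B x);
  frame_dB : forall x, U x -> is_derive x 1 B (- s x *: N x);
  frame_ds : forall x, U x -> is_derive x 1 s (derive1 s x) }.

(** The commutator of an operator with itself is the zero operator [O]. Since [O] equals
    [1 * O + O], linearity of the metric gives g(O, Y) = g(O, Y) + g(O, Y), hence 0. This turns the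
    covariant derivative of T into T'. *)
Lemma bracket_self (G : lieGroup3 R) (g : operator G -> operator G -> G -> R)
    (hg : bi_invariant_metric g) (X : 'I_3 -> operator G)
    (hX : orthonormal_basis g X) (v : 'rV[R]_3) : bracket g X v v = 0.
Proof.
have smooth0 (c : R) : smooth_fun (fun _ : G => c).
  by move=> d _; exact: smooth_on_cst.
pose O : operator G := fun _ _ => 0.
have vfO : vector_field O.
  split=> [f _|a f h _ _ p|f h _ _ p]; [exact: smooth0|..];
  by rewrite /O ?mulr0 addr0.
have -> : bracket g X v v = \row_k g O (X k) 1%g.
  apply/rowP => k; rewrite !mxE; congr (g _ _ _).
  by apply/funext => f; apply/funext => p; rewrite /lie_bracket subrr.
apply/rowP => k; rewrite !mxE.
have := metric_linear (bi_riemannian hg) (smooth0 1) vfO vfO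
  (basis_field hX k) 1%g.
have -> : (fun h q => 1 * O h q + O h q) = O.
  by apply/funext => f; apply/funext => p; rewrite /O mulr0 addr0.
rewrite mul1r => /eqP.
by rewrite -subr_eq0 opprD addrA subrr add0r oppr_eq0 => /eqP.
Qed.

(* [T, N] has no T- and N-components, because the componentwise derivatives of
   an orthonormal frame already form a skew matrix; hence [T, N] = 2 tau_G B. *)
Lemma frenet_moving_frame (G : lieGroup3 R)
    (g : operator G -> operator G -> G -> R) (hg : bi_invariant_metric g)
    (X : 'I_3 -> operator G) (hX : orthonormal_basis g X)
    (U : set R) (openU : open U) (gamma : R -> G) (F : frenet R) :
  frenet_apparatus g X U gamma F ->
  moving_frame U (tan_ F) (nor_ F) (bin_ F) (curv F)
    (fun x => tors F x - tors_G g X F x).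
Proof.
move=> hF; pose s x := tors F x - tors_G g X F x.
have dT x (Ux : U x) := smooth_on_derive1 (frenet_tan_smooth hF) Ux.
have dN x (Ux : U x) := smooth_on_derive1 (frenet_nor_smooth hF) Ux.
have dB x (Ux : U x) := smooth_on_derive1 (frenet_bin_smooth hF) Ux.
have tnb x : U x -> orthonormal3 (tan_ F x) (nor_ F x) (bin_ F x).
  move=> Ux.
  have TT := enorm1_dot (frenet_tan_unit hF Ux).
  have NN := enorm1_dot (frenet_nor_unit hF Ux).
  have TN := frenet_orthogonal hF Ux.
  split; split=> //; rewrite (frenet_bin hF Ux).
  - by rewrite dot_cross_cross TT NN TN expr0n /= subr0 mulr1.
  - by rewrite dotC dot_crossl.
  - by rewrite dotC dot_crossr.
have dTE x : U x -> derive1 (tan_ F) x = curv F x *: nor_ F x.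
  move=> Ux.
  by rewrite -(frenet_tan_eq hF Ux) /cov bracket_self // scaler0 addr0.
have skew (V W : R -> 'rV[R]_3) c x : smooth_on U V -> smooth_on U W ->
    (forall u, U u -> dot (V u) (W u) = c) -> U x ->
    dot (derive1 V x) (W x) = - dot (V x) (derive1 W x).
  move=> sV sW VW Ux; apply/eqP; rewrite -addr_eq0; apply/eqP.
  apply: (is_derive_on_cst openU VW Ux).
  exact: is_derive_dot (smooth_on_derive1 sV Ux) (smooth_on_derive1 sW Ux).
have [sT sN sB] := And3 (frenet_tan_smooth hF) (frenet_nor_smooth hF)
  (frenet_bin_smooth hF).
have self0 (V : R -> 'rV[R]_3) x : smooth_on U V ->
    (forall u, U u -> dot (V u) (V u) = 1) -> U x ->
    dot (derive1 V x) (V x) = 0.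
  move=> sV VV Ux; have := skew _ _ _ _ sV sV VV Ux.
  by rewrite [dot (V x) _]dotC => h; lra.
(* The B-component of the equation for D_T N: the bracket term contributes tau_G, so <N', B> = tau -
   tau_G. *)
have dNB x : U x -> dot (derive1 (nor_ F) x) (bin_ F x) = s x.
  move=> Ux; have [[TT NN BB] [TN TB NB]] := tnb _ Ux.
  have := congr1 (@dot R ^~ (bin_ F x)) (frenet_nor_eq hF Ux).
  rewrite /cov /= !(dotDl, dotZl) BB TB /s /tors_G => h; lra.
(* The components along T and N come from [skew] and [self0], with T' known from [dTE]. *)
have dNE x : U x ->
    derive1 (nor_ F) x = - curv F x *: tan_ F x + s x *: bin_ F x.
  move=> Ux; have [[TT NN BB] [TN TB NB]] := tnb _ Ux.
  apply: (orthonormal3_eqP (tnb _ Ux)); rewrite !(dotDl, dotZl).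
  - rewrite (skew _ _ 0 _ sN sT _ Ux) => [|u /tnb[_ []]]; last first.
      by move=> *; rewrite dotC.
    by rewrite dTE // dotZr NN TT [dot (bin_ F x) _]dotC TB; ring.
  - rewrite self0 // => [|u /tnb[[]]//].
    by rewrite TN [dot (bin_ F x) _]dotC NB; ring.
  - by rewrite dNB // TB BB; ring.
have dBE x : U x -> derive1 (bin_ F) x = - s x *: nor_ F x.
  move=> Ux; have [[TT NN BB] [TN TB NB]] := tnb _ Ux.
  apply: (orthonormal3_eqP (tnb _ Ux)); rewrite !(dotDl, dotZl).
  - rewrite (skew _ _ 0 _ sB sT _ Ux) => [|u /tnb[_ []]]; last first.
      by move=> *; rewrite dotC.
    rewrite dTE // dotZr [dot (bin_ F x) _]dotC NB [dot _ (tan_ F x)]dotC TN.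
    by ring.
  - rewrite (skew _ _ 0 _ sB sN _ Ux) => [|u /tnb[_ []]]; last first.
      by move=> *; rewrite dotC.
    by rewrite dotC dNB // NN; ring.
  - by rewrite self0 ?NB ?mulr0 // => u /tnb[[]].
split=> // x Ux.
- by rewrite -dTE //; exact: dT.
- by rewrite -dNE //; exact: dN.
- by rewrite -dBE //; exact: dB.
(* No regularity of [tors] is assumed; s is differentiable because it equals <N', B> on [U]. *)
- have [ds _] := is_derive_on openU dNB Ux
    (is_derive_dot (smooth_on_derivable_derive1 sN Ux) (dB _ Ux)).
  by rewrite derive1E; exact/derivableP.
Qed.

End Frame.

(** * The offset relation with constant [c], differentiated along the second curve *)

Section Mannheim.
Variables (R : realType) (I J : set R) (openJ : open J).
Variables (T N B t n b : R -> 'rV[R]_3) (kap sig k s : R -> R).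
Hypotheses (frameI : moving_frame I T N B kap sig)
           (frameJ : moving_frame J t n b k s).
Variables (phi dphi : R -> R).
Hypotheses (phiI : forall x, J x -> I (phi x))
           (phi_derive : forall x, J x -> is_derive x 1 phi (dphi x)).

Let dT_phi x : J x ->
  is_derive x 1 (T \o phi) (dphi x *: (kap (phi x) *: N (phi x))).
Proof.
move=> Jx.
exact: is_derive_comp_mx (frame_dT frameI (phiI Jx)) (phi_derive Jx).
Qed.

Let dN_phi x : J x -> is_derive x 1 (N \o phi)
  (dphi x *: (- kap (phi x) *: T (phi x) + sig (phi x) *: B (phi x))).
Proof.
move=> Jx.
exact: is_derive_comp_mx (frame_dN frameI (phiI Jx)) (phi_derive Jx).
Qed.

Section Offset.
Variable c : R.
Hypothesis offsetJ :
  forall x, J x -> dphi x *: T (phi x) = t x - (c * s x) *: n x.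

Let dot_T x : J x -> [/\ dphi x * dot (T (phi x)) (t x) = 1,
  dphi x * dot (T (phi x)) (n x) = - (c * s x) &
  dphi x * dot (T (phi x)) (b x) = 0].
Proof.
move=> Jx; have [[tt nn bb] [tn tb nb]] := frame_orthonormal frameJ Jx.
rewrite -!dotZl offsetJ // !(dotDl, dotNl, dotZl) tt nn tn tb nb.
by rewrite [dot (n x) _]dotC tn; split; ring.
Qed.

Lemma offset_speed_neq0 x : J x -> dphi x != 0.
Proof.
move=> Jx; apply/eqP => d0; have [+ _ _] := dot_T Jx.
by rewrite d0 mul0r => /esym/eqP; rewrite oner_eq0.
Qed.

(* Differentiate <T o phi, n + c s t> = 0. *)
Lemma offset_osculating x : J x ->
  dphi x ^+ 2 * kap (phi x) *
    (dot (N (phi x)) (n x) + c * s x * dot (N (phi x)) (t x)) =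
  k x * (1 + c ^+ 2 * s x ^+ 2) - c * derive1 s x.
Proof.
pose f u := dot (T (phi u)) (n u) + c * (s u * dot (T (phi u)) (t u)).
have f0 u : J u -> f u = 0.
  move=> Ju; have [Tt Tn _] := dot_T Ju.
  apply: (mulfI (offset_speed_neq0 Ju)).
  rewrite mulr0 /f mulrDr Tn mulrCA [dphi u * _]mulrCA Tt.
  by ring.
move=> Jx; have [Tt Tn Tb] := dot_T Jx.
have df := is_deriveD (is_derive_dot (dT_phi Jx) (frame_dN frameJ Jx))
  (is_derive_mul (is_derive_cst c x 1)
    (is_derive_mul (frame_ds frameJ Jx)
      (is_derive_dot (dT_phi Jx) (frame_dT frameJ Jx)))).
have := is_derive_on_cst openJ f0 Jx df.
rewrite /= !(dotZl, dotZr, dotDr); set E := (X in X = 0 -> _) => E0.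
apply/eqP; rewrite -subr_eq0; apply/eqP.
set A := dot (T (phi x)) (t x) in Tt E E0 *.
set C := dot (T (phi x)) (n x) in Tn E E0 *.
set D := dot (T (phi x)) (b x) in Tb E E0 *.
(* The difference of the two sides is [dphi x] times the differentiated relation [E], plus multiples
   of the three components [Tt], [Tn], [Tb] of the offset relation. *)
transitivity (dphi x * E + (k x - c * derive1 s x) * (dphi x * A - 1)
  - c * s x * k x * (dphi x * C + c * s x) - s x * (dphi x * D)).
  by rewrite /E /cst; ring.
by rewrite E0 Tt Tn Tb; ring.
Qed.

(** Differentiate <T o phi, b> = 0. The identity serves to show that, for c <> 0, the curvature
    [kap (phi x)] is nonzero wherever s is. *)
Lemma offset_binormal x : J x ->
  dphi x ^+ 2 * kap (phi x) * dot (N (phi x)) (b x) = - (c * s x ^+ 2).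
Proof.
have f0 u : J u -> dot (T (phi u)) (b u) = 0.
  move=> Ju; have [_ _ Tb] := dot_T Ju.
  by apply: (mulfI (offset_speed_neq0 Ju)); rewrite Tb mulr0.
move=> Jx; have [_ Tn _] := dot_T Jx.
have := is_derive_on_cst openJ f0 Jx
  (is_derive_dot (dT_phi Jx) (frame_dB frameJ Jx)).
rewrite /= !(dotZl, dotZr); set E := (X in X = 0 -> _) => E0.
set C := dot (T (phi x)) (n x) in Tn E E0 *.
apply/eqP; rewrite -subr_eq0; apply/eqP.
transitivity (dphi x * E + s x * (dphi x * C + c * s x)).
  by rewrite /E; ring.
by rewrite E0 Tn; ring.
Qed.

Hypothesis k_neq0 : forall x, J x -> k x != 0.

(* Where s <> 0 the curvature of the first curve does not vanish and its normal
   is determined by T'.  At a zero of s, the equation makes s' nonzero, so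
   that differentiating s <N o phi, n> = 0 still gives <N o phi, n> = 0. *)
Lemma offset_ode_normal : c != 0 ->
  (forall x, J x -> c * derive1 s x = k x * (1 + c ^+ 2 * s x ^+ 2)) ->
  forall x, J x -> N (phi x) = dot (N (phi x)) (b x) *: b x.
Proof.
move=> c0 ode.
(* Pair the offset relation with N o phi, which is orthogonal to T o phi. *)
have Nt u : J u -> dot (N (phi u)) (t u) = c * s u * dot (N (phi u)) (n u).
  move=> Ju; have [_ [TN _ _]] := frame_orthonormal frameI (phiI Ju).
  have : dot (N (phi u)) (dphi u *: T (phi u)) = 0.
    by rewrite dotZr dotC TN mulr0.
  by rewrite offsetJ // dotDr dotNr dotZr => /eqP; rewrite subr_eq0 => /eqP.
have sNn u : J u -> s u * dot (N (phi u)) (n u) = 0.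
  move=> Ju; have [->|s0] := eqVneq (s u) 0; first by rewrite mul0r.
  have kap0 : dphi u ^+ 2 * kap (phi u) != 0.
    have := offset_binormal Ju; apply: contra_eqN => /eqP ->.
    by rewrite mul0r eq_sym oppr_eq0 mulf_neq0 // expf_neq0.
  (* The equation makes the right-hand side zero, and by [Nt] the last factor on the left is (1 +
     c^2 s^2) <N o phi, n>, whose first factor is positive. *)
  have := offset_osculating Ju; rewrite -ode // subrr => /eqP.
  rewrite mulf_eq0 (negPf kap0) /= Nt // mulrA -expr2 exprMn.
  rewrite -{1}[dot _ _]mul1r -mulrDl mulf_eq0 gt_eqF /= => [/eqP->|]; first by rewrite mulr0.
  by rewrite ltr_pwDl // mulr_ge0 // sqr_ge0.
move=> x Jx; have [[tt nn bb] [tn tb nb]] := frame_orthonormal frameJ Jx.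
have Nn : dot (N (phi x)) (n x) = 0.
  have /eqP := sNn x Jx; rewrite mulf_eq0 => /orP[/eqP s0|/eqP //].
  have := is_derive_on_cst openJ sNn Jx (is_derive_mul (frame_ds frameJ Jx)
    (is_derive_dot (dN_phi Jx) (frame_dN frameJ Jx))).
  rewrite s0 mul0r addr0 => /eqP; rewrite mulf_eq0 => /orP[/eqP ds0|/eqP //].
  have := ode x Jx; rewrite ds0 s0 expr0n /= !mulr0 addr0 mulr1 => /esym/eqP.
  by rewrite (negPf (k_neq0 Jx)).
rewrite {1}(orthonormal3_expand (N (phi x)) (frame_orthonormal frameJ Jx)).
by rewrite Nt // Nn mulr0 !scale0r !add0r.
Qed.

End Offset.

(** The function e = <N o phi, b> has square 1, and its derivative vanishes: N' is orthogonal to N,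
    hence to b, while b' is a multiple of n, which is orthogonal to b and so to N o phi. Thus e is
    constant on the interval [J]. *)
Lemma parallel_normal_sign : is_interval J ->
  (forall x, J x -> N (phi x) = dot (N (phi x)) (b x) *: b x) ->
  exists2 eps : R, eps ^+ 2 = 1 & forall x, J x -> N (phi x) = eps *: b x.
Proof.
move=> itvJ Nb; pose e x := dot (N (phi x)) (b x).
have [[x0 Jx0]|J0] := pselect (exists x, J x); last first.
  (* If [J] is empty, any sign will do. *)
  by exists 1 => [|x Jx]; [rewrite expr1n|case: J0; exists x].
have e1 x : J x -> e x ^+ 2 = 1.
  move=> Jx; have [[_ NN _] _] := frame_orthonormal frameI (phiI Jx).
  by rewrite expr2 {1}/e -dotZr -Nb.
exists (e x0) => [|x Jx]; first exact: e1.
suff <- : e x = e x0 by exact: Nb.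
apply: (is_derive0_interval itvJ) => // u Ju.
have bN : b u = e u *: N (phi u) by rewrite Nb // scalerA -expr2 e1 ?scale1r.
have := is_derive_dot (dN_phi Ju) (frame_dB frameJ Ju).
congr (is_derive _ _ _ _).
have [_ [_ _ nb]] := frame_orthonormal frameJ Ju.
have [_ [TN _ NB]] := frame_orthonormal frameI (phiI Ju).
have Nn : dot (N (phi u)) (n u) = 0.
  by rewrite Nb // dotZl [dot (b u) (n u)]dotC nb mulr0.
have Bb w : dot w (b u) = e u * dot w (N (phi u)) by rewrite bN dotZr.
rewrite /= dotZl dotZr Nn Bb dotDl !dotZl TN [dot (B _) _]dotC NB.
by ring.
Qed.

Section ParallelNormal.
Variable eps : R.
Hypotheses (eps1 : eps ^+ 2 = 1)
           (N_eps : forall x, J x -> N (phi x) = eps *: b x).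

Lemma parallel_offset_ode c :
  (forall x, J x -> dphi x *: T (phi x) = t x - (c * s x) *: n x) ->
  forall x, J x -> c * derive1 s x = k x * (1 + c ^+ 2 * s x ^+ 2).
Proof.
move=> off x Jx; have := offset_osculating off Jx.
have [_ [_ tb nb]] := frame_orthonormal frameJ Jx.
rewrite N_eps // !dotZl ![dot (b x) _]dotC tb nb !mulr0 addr0 mulr0.
by move/esym/eqP; rewrite subr_eq0 => /eqP.
Qed.

(** Differentiating N o phi = eps b gives phi' N' = - eps s n. As eps^2 = 1 and psi' phi' = 1, the
    term - eps c N' equals psi' c s n, so the two relations differ only by the factor psi'. This is
    where lambda = - eps c comes from. *)
Lemma parallel_offset_sym c x dpsi dN : J x -> dpsi * dphi x = 1 ->
  is_derive (phi x) 1 N dN ->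
  dpsi *: t x = T (phi x) - (eps * c) *: dN <->
  dphi x *: T (phi x) = t x - (c * s x) *: n x.
Proof.
move=> Jx dd hN.
have EN : dphi x *: dN = (- eps * s x) *: n x.
  apply: is_derive_unique (is_derive_comp_mx hN (phi_derive Jx)) _.
  have eb : is_derive x 1 (eps \*: b) (eps *: (- s x *: n x)).
    exact: is_deriveZ (frame_dB frameJ Jx).
  rewrite mulNr -mulrN -scalerA.
  by apply: (is_derive_on openJ _ Jx eb) => u Ju /=; rewrite N_eps.
have {EN}-> : (eps * c) *: dN = - (dpsi *: ((c * s x) *: n x)).
  have -> : dN = dpsi *: (dphi x *: dN) by rewrite scalerA dd scale1r.
  rewrite EN !scalerA -scaleNr; congr (_ *: _).
  by transitivity (- eps ^+ 2 * (dpsi * (c * s x))); [ring|rewrite eps1; ring].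
rewrite opprK; split=> [h|h].
  have -> : T (phi x) = dpsi *: (t x - (c * s x) *: n x).
    by rewrite scalerBr h addrK.
  by rewrite scalerA mulrC dd scale1r.
have -> : t x = dphi x *: T (phi x) + (c * s x) *: n x by rewrite h subrK.
by rewrite scalerDr scalerA dd scale1r.
Qed.

End ParallelNormal.
End Mannheim.

(** * Inverse parameter changes *)

Section Correspondence.
Variables (R : realType) (I J : set R) (psi psi' : R -> R).
Hypothesis corr : correspondence I J psi psi'.

Lemma corr_mem s : I s -> J (psi s).
Proof. by move=> Is; case: (corr_bij corr) => + _ _; apply. Qed.

Lemma corr_mem' x : J x -> I (psi' x).
Proof. by move=> Jx; case: (corr_bij' corr) => + _ _; apply. Qed.

Lemma corr_K' x : J x -> psi (psi' x) = x.
Proof.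
move=> Jx; have [_ _ /(_ x Jx)[s Is <-]] := corr_bij corr.
by rewrite (corr_K corr).
Qed.

Lemma corr_derive_mul (openJ : open J) x : J x ->
  derive1 psi (psi' x) * derive1 psi' x = 1.
Proof.
move=> Jx.
have d := is_derive1_comp (smooth_on_derive1 (corr_smooth corr) (corr_mem' Jx))
  (smooth_on_derive1 (corr_smooth' corr) Jx).
exact: is_derive_unique (is_derive_on openJ corr_K' Jx d) (is_derive_id x 1).
Qed.

End Correspondence.

(** * Equivalence of the partner relation and the differential equation *)

Theorem theorem3p5 (R : realType) (G : lieGroup3 R)
    (g : operator G -> operator G -> G -> R) (hg : bi_invariant_metric g)
    (X : 'I_3 -> operator G) (hX : orthonormal_basis g X)
    (I J : set R) (hI : open I) (hI' : is_interval I)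
    (hJ : open J) (hJ' : is_interval J)
    (alpha beta : R -> G) (F Fb : frenet R)
    (hF : frenet_apparatus g X I alpha F)
    (hFb : frenet_apparatus g X J beta Fb)
    (hcurv : forall t, J t -> curv Fb t != 0) :
  mannheim_partner I J F Fb <->
  exists (psi psi' : R -> R) (mu : R -> R),
    [/\ correspondence I J psi psi',
        smooth_on J mu,
        offset J psi' (tan_ Fb) (bin_ Fb) (tan_ F) mu,
        exists2 c : R, c != 0 & forall t, J t -> mu t = c &
        forall t, J t ->
          derive1 (fun u => curv Fb u * harmonic_curv g X Fb u) t =
          curv Fb t / mu t *
            (1 + mu t ^+ 2 * curv Fb t ^+ 2 * harmonic_curv g X Fb t ^+ 2)].
Proof.
have frameI := frenet_moving_frame hg hX hI hF.
have frameJ := frenet_moving_frame hg hX hJ hFb.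
set T := tan_ F in frameI *; set N := nor_ F in frameI *.
set t := tan_ Fb in frameJ *; set n := nor_ Fb in frameJ.
set b := bin_ Fb in frameJ *; set k := curv Fb in hcurv frameJ *.
set s := (fun x => tors Fb x - tors_G g X Fb x) in frameJ.
(* Nonvanishing curvature makes the division in H a genuine one. *)
have kH x : J x -> k x * harmonic_curv g X Fb x = s x.
  by move=> Jx; rewrite /harmonic_curv mulrC divfK // hcurv.
have dkH x : J x ->
    derive1 (fun u => k u * harmonic_curv g X Fb u) x = derive1 s x.
  move=> Jx; apply: is_derive_derive1.
  by apply: (is_derive_on hJ _ Jx (frame_ds frameJ Jx)) => u /kH.
have odeE c x : c != 0 -> J x ->
    derive1 (fun u => k u * harmonic_curv g X Fb u) x =
      k x / c * (1 + c ^+ 2 * k x ^+ 2 * harmonic_curv g X Fb x ^+ 2) <->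
    c * derive1 s x = k x * (1 + c ^+ 2 * s x ^+ 2).
  move=> c0 Jx; rewrite dkH //.
  have -> : c ^+ 2 * k x ^+ 2 * harmonic_curv g X Fb x ^+ 2 = c ^+ 2 * s x ^+ 2.
    by rewrite -(kH x Jx); ring.
  split=> [->|e]; first by field.
  by apply: (mulfI c0); rewrite e; field.
(* For constant [mu] the term mu' b drops out, and mu b' = - c s n. *)
have offsetJE psi' mu c : (forall x, J x -> mu x = c) -> smooth_on J mu ->
    offset J psi' t b T mu <->
    forall x, J x -> derive1 psi' x *: T (psi' x) = t x - (c * s x) *: n x.
  move=> muc smu.
  have E x : J x -> t x + derive1 mu x *: b x + mu x *: derive1 b x =
      t x - (c * s x) *: n x.
    move=> Jx; rewrite (is_derive_on_cst hJ muc Jx (smooth_on_derive1 smu Jx)).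
    rewrite (is_derive_derive1 (frame_dB frameJ Jx)) muc // scale0r addr0.
    by rewrite scalerA mulrN scaleNr.
  by split=> off x Jx; [rewrite off // E|rewrite E // off].
have dN u : I u -> is_derive u 1 N (derive1 N u).
  by move=> Iu; exact: smooth_on_derive1 (frenet_nor_smooth hF) Iu.
split=> [[psi [psi' [corr [dep [lam [slam off]]]]]]|].
  have phiI := corr_mem' corr; have psiK := corr_K' corr.
  have dphi x (Jx : J x) := smooth_on_derive1 (corr_smooth' corr) Jx.
  have Nb x : J x -> N (psi' x) = dot (N (psi' x)) (b x) *: b x.
    move=> Jx; apply: dependent_unit.
    - by have [[]] := frame_orthonormal frameI (phiI _ Jx).
    - by have [[]] := frame_orthonormal frameJ Jx.
    - by have := dep _ (phiI _ Jx); rewrite psiK.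
  have [eps eps1 Neps] := parallel_normal_sign frameI frameJ phiI dphi hJ' Nb.
  (* Pair the offset relation with N: T and N' are orthogonal to N, and so is [t (psi u)], because N
     is parallel to b there. Only lambda' remains. *)
  have dlam u : I u -> derive1 lam u = 0.
    move=> Iu; have Ju := corr_mem corr Iu.
    have [[_ NN _] [TN _ NB]] := frame_orthonormal frameI Iu.
    have [_ [_ tb _]] := frame_orthonormal frameJ Ju.
    have tN : dot (t (psi u)) (N u) = 0.
      by rewrite -[u in N u](corr_K corr Iu) Neps // dotZr tb mulr0.
    have := congr1 (@dot R ^~ (N u)) (off _ Iu).
    rewrite (is_derive_derive1 (frame_dN frameI Iu)) !(dotDl, dotZl) TN NN.
    by rewrite -/t tN [dot (bin_ F u) _]dotC NB => h; lra.
  (* For empty [J] all conditions are vacuous except c <> 0, which the constant 1 meets. Otherwise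
     [x0] supplies the value of lambda and the proof of c <> 0. *)
  have [[x0 Jx0]|J0] := pselect (exists x, J x); last first.
    exists psi, psi', (fun=> 1); split=> //; first exact: smooth_on_cst.
    - by move=> x Jx; case: J0; exists x.
    - by exists 1; rewrite ?oner_eq0.
    - by move=> x Jx; case: J0; exists x.
  pose l := lam (psi' x0).
  have lamE u : I u -> lam u = l.
    move=> Iu; apply: (is_derive0_interval hI') => // [v Iv|]; last exact: phiI.
    by rewrite -(dlam _ Iv); exact: smooth_on_derive1 slam Iv.
  (* Solves l = - eps c, as eps^2 = 1. *)
  pose c := - (eps * l).
  have offJ x : J x -> derive1 psi' x *: T (psi' x) = t x - (c * s x) *: n x.
    move=> Jx; have Ix := phiI _ Jx.
    apply: (parallel_offset_sym hJ T frameJ dphi eps1 Neps c Jx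
      (corr_derive_mul corr hJ Jx) (dN _ Ix)).1.
    have := off _ Ix; rewrite psiK // dlam // scale0r addr0 lamE // => ->.
    rewrite /c mulrN scaleNr opprK; congr (_ + _ *: _).
    by rewrite mulrA -expr2 eps1 mul1r.
  have ode := parallel_offset_ode hJ frameI frameJ phiI dphi Neps offJ.
  (* With c = 0 the equation at [x0] would read 0 = k. *)
  have c0 : c != 0.
    apply/eqP => c0; have := ode _ Jx0; rewrite c0 expr2 !mul0r addr0 mulr1.
    by move/esym/eqP; rewrite (negPf (hcurv _ Jx0)).
  exists psi, psi', (fun=> c); split=> //; first exact: smooth_on_cst.
  - by apply/(offsetJE psi' (fun=> c) c) => //; exact: smooth_on_cst.
  - by exists c.
  - by move=> x Jx; apply/odeE => //; exact: ode.
move=> [psi [psi' [mu [corr smu offmu [c c0 muc] odemu]]]].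
have phiI := corr_mem' corr; have psiK := corr_K' corr.
have dphi x (Jx : J x) := smooth_on_derive1 (corr_smooth' corr) Jx.
have offJ := (offsetJE _ _ _ muc smu).1 offmu.
have ode x (Jx : J x) : c * derive1 s x = k x * (1 + c ^+ 2 * s x ^+ 2).
  by apply/odeE => //; rewrite odemu // muc.
have Nb := offset_ode_normal hJ frameI frameJ phiI dphi offJ hcurv c0 ode.
have [eps eps1 Neps] := parallel_normal_sign frameI frameJ phiI dphi hJ' Nb.
exists psi, psi'; split=> //; split.
  move=> u Iu; have Ju := corr_mem corr Iu.
  have -> : nor_ F u = eps *: b (psi u) by rewrite -Neps // (corr_K corr Iu).
  exact: scale_dependent.
(* The value of lambda matching mu = c; being constant, it contributes no lambda' N term. *)
exists (fun=> - (eps * c)); split=> [|u Iu]; first exact: smooth_on_cst.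
have Ju := corr_mem corr Iu.
have dpsi := corr_derive_mul corr hJ Ju.
have hN := dN _ Iu.
rewrite -/T -/N -/t derive1_cst scale0r addr0 scaleNr.
have := parallel_offset_sym hJ T frameJ dphi eps1 Neps c Ju dpsi.
rewrite (corr_K corr Iu) => /(_ _ hN)[_ -> //].
by have := offJ _ Ju; rewrite (corr_K corr Iu).
Qed.
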